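(* Let $C_7$ be the commutative $7$-element quandle, and let $\Delta=\Delta(C_7)=\langle f_1,\ldots,f_6\rangle$ be the augmentation ideal of $\mathbb{Z}[C_7]$. The powers of $\Delta$ are given by $$\Delta^{6k}=\langle 7^{k-1}(f_1+\cdots+f_6),\;7^kf_2,\;7^kf_3,\;7^kf_4,\;7^kf_5,\;7^kf_6\rangle,\quad k=1,2,\ldots,$$ $$\Delta^{6k+1}=\langle 7^kf_1,\ldots,7^kf_6\rangle,\quad k=0,1,\ldots,$$ $$\Delta^{6k+2}=\langle 7^k(f_1+f_6),\;7^k(f_2+2f_6),\;7^k(f_3+3f_6),\;7^k(f_4+4f_6),\;7^k(f_5+5f_6),\;7^{k+1}f_6\rangle,\quad k=0,1,\ldots,$$ $$\Delta^{6k+3}=\langle 7^k(f_1+6f_5+3f_6),\;7^k(f_2+4f_5+f_6),\;7^k(f_3+f_5+f_6),\;7^k(f_4+4f_5+3f_6),\;7^{k+1}f_5,\;7^{k+1}f_6\rangle,\quad k=0,1,\ldots,$$ $$\Delta^{6k+4}=\langle 7^k(f_1+f_4+3f_5+6f_6),\;7^k(f_2+4f_4+6f_5+6f_6),\;7^k(f_3+3f_4+6f_5+3f_6),\;7^{k+1}f_4,\;7^{k+1}f_5,\;7^{k+1}f_6\rangle,\quad k=0,1,\ldots,$$ $$\Delta^{6k+5}=\langle 7^k(f_1+6f_3+5f_4+4f_5+3f_6),\;7^k(f_2+2f_3+3f_4+4f_5+5f_6),\;7^{k+1}f_3,\;7^{k+1}f_4,\;7^{k+1}f_5,\;7^{k+1}f_6\rangle,\quad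 k=0,1,\ldots.$$
   Context: $C_7$ is the quandle on $\mathbb{Z}_7$ with operation $x*y=4(x+y)$. The quandle ring $\mathbb{Z}[C_7]$ is the free $\mathbb{Z}$-module with basis $a_0,\ldots,a_6$ and the bilinear (non-associative) product with $a_ia_j=a_{4(i+j)}$, indices modulo $7$. The augmentation map is $\varepsilon(\sum\alpha_ia_i)=\sum\alpha_i$ and $\Delta(C_7)=\ker\varepsilon$. Put $f_i=a_i-a_0$ for $i=1,\ldots,6$; these form a $\mathbb{Z}$-basis of $\Delta(C_7)$. Powers are defined by $\Delta^1=\Delta$ and $\Delta^{m+1}=\Delta^m\Delta$, where $IJ$ is the additive subgroup generated by all products $ab$ with $a\in I$, $b\in J$. $\langle\cdots\rangle$ denotes the $\mathbb{Z}$-span. *)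

(* Defs.v *)
From mathcomp Require Import all_boot all_order all_algebra ring.
From mathcomp Require Import boolp classical_sets.

Set Implicit Arguments.
Unset Strict Implicit.
Unset Printing Implicit Defensive.

Import GRing.Theory.

Local Open Scope classical_set_scope.
Local Open Scope ring_scope.

Record quandle := Quandle {
  qcarrier :> finType;
  qop : qcarrier -> qcarrier -> qcarrier;
  qop_idem : forall x, qop x x = x;
  qop_bij : forall y, bijective (qop ^~ y);
  qop_distr : forall x y z, qop (qop x y) z = qop (qop x z) (qop y z) }.

Section QuandleRing.

Variable Q : quandle.

(* The quandle ring Z[Q] is the additive group {ffun Q -> int} with the product
   qrmul, not the pointwise product of functions. *)
Definition qbase (x : Q) : {ffun Q -> int} := [ffun y => (x == y)%:R].

Definition qrmul (u v : {ffun Q -> int}) : {ffun Q -> int} :=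
  \sum_(x : Q) \sum_(y : Q) qbase (qop x y) *~ (u x * v y).

Definition augmentation (u : {ffun Q -> int}) : int := \sum_(x : Q) u x.

Definition augmentation_ideal : set {ffun Q -> int} :=
  [set u | augmentation u = 0].

End QuandleRing.

Arguments augmentation_ideal : clear implicits.

Definition additive_subgroup (V : zmodType) (A : set V) : Prop :=
  A 0 /\ (forall x y, A x -> A y -> A (x - y)).

Definition additive_span (V : zmodType) (S : set V) : set V :=
  smallest (@additive_subgroup V) S.

Definition subgroup_mul (Q : quandle) (I J : set {ffun Q -> int}) :
    set {ffun Q -> int} :=
  additive_span [set w | exists a b, [/\ I a, J b & w = qrmul a b]].

(* augmentation_power Q m is Delta^m for m >= 1, with Delta^(m+1) equal to
   Delta^m Delta (left-normed: the product is not associative). The value at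
   m = 0 is a dummy. *)
Definition augmentation_power (Q : quandle) (m : nat) : set {ffun Q -> int} :=
  iter m.-1 (fun I => subgroup_mul I (augmentation_ideal Q))
    (augmentation_ideal Q).

Arguments augmentation_power : clear implicits.

Definition Zspan (V : zmodType) (s : seq V) : set V :=
  [set v | inIntSpan (in_tuple s) v].

Definition C7_op (x y : 'Z_7) : 'Z_7 := 4 * (x + y).

Lemma C7_char : 7 = 0 :> 'Z_7.
Proof. exact: val_inj. Qed.

Lemma C7_idem x : C7_op x x = x.
Proof.
have -> : C7_op x x = x + 7 * x by rewrite /C7_op; ring.
by rewrite C7_char mul0r addr0.
Qed.

Lemma C7_bij y : bijective (C7_op ^~ y).
Proof.
exists (fun x => 2 * x - y) => x.
- have -> : 2 * C7_op x y - y = x + 7 * (x + y) by rewrite /C7_op; ring.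
  by rewrite C7_char mul0r addr0.
- have -> : C7_op (2 * x - y) y = x + 7 * x by rewrite /C7_op; ring.
  by rewrite C7_char mul0r addr0.
Qed.

Lemma C7_distr x y z : C7_op (C7_op x y) z = C7_op (C7_op x z) (C7_op y z).
Proof.
have -> : C7_op (C7_op x z) (C7_op y z) = C7_op (C7_op x y) z + 7 * (4 * z).
  by rewrite /C7_op; ring.
by rewrite C7_char mul0r addr0.
Qed.

Definition C7 : quandle := @Quandle 'Z_7 C7_op C7_idem C7_bij C7_distr.

Lemma C7_comm (x y : C7) : qop x y = qop y x.
Proof. by rewrite /= /C7_op addrC. Qed.

Definition C7_a (i : 'Z_7) : {ffun C7 -> int} := @qbase C7 i.

Definition C7_f (i : 'Z_7) : {ffun C7 -> int} := C7_a i - C7_a 0.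

(* Main.v *)
From HB Require Import structures.
Require Import Defs.
From mathcomp Require Import all_boot all_order all_algebra ring zify.
From mathcomp Require Import boolp classical_sets.

Set Implicit Arguments.
Unset Strict Implicit.
Unset Printing Implicit Defensive.

Import GRing.Theory Num.Theory.

Local Open Scope classical_set_scope.
Local Open Scope ring_scope.

(** The product of Z[C7] is the group-ring product of Z[Z/7] followed by the
    group automorphism x |-> 4 x. The ideal powers of the group ring are stable
    under automorphisms, so the powers of Delta are those of the augmentation
    ideal of Z[X]/(X^7 - 1), that is, the multiples of (X - 1)^m. Modulo 7 this
    quotient is F_7[X]/(X - 1)^7, where divisibility by (X - 1)^r, r <= 7, is
    tested by the moments sum_x u_x x^j, j < r. This suggests, for
    1 <= r <= 7,

      Delta^(6k+r) = 7^k L_r,   L_r = {u | sum_x u_x = 0 in Z, and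
                                        sum_x u_x x^j = 0 mod 7 for j < r},

    where L_r is [moment_ideal r] below, and it is consistent because
    L_7 = 7 L_1.

    The recursion L_r Delta = L_(r+1), for r <= 6, has two halves. The moments
    of a product expand binomially in the moments of the factors, and for an
    element of L_r times an element of Delta every term vanishes up to order r
    ([moment_ideal_qrmul]). Conversely every u in L_(r+1) is a single product
    w f_1 with w in L_r ([moment_ideal_factor]): w is a discrete antiderivative
    of u, the first moment of u makes it possible to normalise w to augmentation
    0, and the moments of w are read off from those of u by dividing by the
    numbers 1, ..., r, which are units modulo 7.

    The bases come from Lagrange interpolation: an element of L_r whose
    coordinates 1, ..., 7 - r vanish is supported on r points, so integrating
    the polynomial of degree r - 1 that isolates one of these points shows that
    all its coordinates are divisible by 7 ([moment_ideal_dvd]). With r = 7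
    this is L_7 = 7 L_1; for r <= 6 it shows that L_r is spanned by the
    7 f_i, i > 7 - r, and any g_1, ..., g_(7-r) in L_r that are dual to the
    first 7 - r coordinates ([moment_ideal_Zspan]). Each list of the theorem has
    this shape, so what is left is arithmetic modulo 7. *)

(** * Subgroups and integer spans *)

Section AdditiveSubgroup.

Variables (V : zmodType) (A : set V).
Hypothesis AG : additive_subgroup A.

Lemma subgroupN x : A x -> A (- x).
Proof. by move=> Ax; rewrite -sub0r; apply: AG.2 => //; apply: AG.1. Qed.

Lemma subgroupD x y : A x -> A y -> A (x + y).
Proof.
by move=> Ax Ay; rewrite -[y]opprK; apply: AG.2 => //; apply: subgroupN.
Qed.

Lemma subgroup_sum (I : Type) (s : seq I) (P : pred I) (F : I -> V) :
  (forall i, P i -> A (F i)) -> A (\sum_(i <- s | P i) F i).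
Proof.
move=> AF; apply: big_ind => //; [exact: AG.1 | exact: subgroupD].
Qed.

Lemma subgroup_mulrz x n : A x -> A (x *~ n).
Proof.
move=> Ax; have An m : A (x *+ m).
  elim: m => [|m Am]; first exact: AG.1.
  by rewrite mulrS; apply: subgroupD.
by case: n => m; [exact: An | rewrite NegzE mulrNz; apply/subgroupN/An].
Qed.

End AdditiveSubgroup.

Lemma ffunMzE (T : finType) (V : zmodType) (u : {ffun T -> V}) n x :
  (u *~ n) x = u x *~ n.
Proof. by case: n => n; rewrite ?NegzE ?mulrNz ?ffunE -?pmulrn ffunMnE. Qed.

Lemma ZspanP (V : zmodType) (s : seq V) v :
  Zspan s v <-> exists a : nat -> int, v = \sum_(i < size s) s`_i *~ a i.
Proof.
split=> -[a ->]; last first.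
  by exists [ffun i : 'I__ => a i]; apply: eq_bigr => i _; rewrite ffunE.
exists (fun i => oapp a 0 (insub i)); apply: eq_bigr => i _.
by rewrite valK.
Qed.

Lemma Zspan_mulrn (V : zmodType) (s : seq V) n :
  Zspan [seq x *+ n | x <- s] = [set v *+ n | v in Zspan s].
Proof.
have E a : \sum_(i < size s) (s`_i *~ a (val i)) *+ n =
   \sum_(i < size [seq x *+ n | x <- s]) [seq x *+ n | x <- s]`_i *~ a (val i).
  rewrite size_map; apply: eq_bigr => i _.
  by rewrite (nth_map 0) // !pmulrn mulrzAC.
apply/seteqP; split=> [v /ZspanP[a ->] | _ [v /ZspanP[a ->] <-]].
  rewrite -E sumrMnl; exists (\sum_(i < size s) s`_i *~ a i) => //.
  by apply/ZspanP; exists a.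
by rewrite -sumrMnl E; apply/ZspanP; exists a.
Qed.

(** * Linear functionals on a quandle ring *)

Section Pairing.

Variables (Q : quandle) (R : pzRingType).

(** The additive extension of phi from Q to Z[Q]. The augmentation, the
    moments and the coordinates are all of this form, which gives them one
    formula on products. *)
Definition pairing (phi : Q -> R) (u : {ffun Q -> int}) : R :=
  \sum_(x : Q) (u x)%:~R * phi x.

Lemma pairingB phi u v : pairing phi (u - v) = pairing phi u - pairing phi v.
Proof.
rewrite -sumrB; apply: eq_bigr => x _.
by rewrite !ffunE rmorphB mulrBl.
Qed.

HB.instance Definition _ phi :=
  GRing.isZmodMorphism.Build {ffun Q -> int} R (pairing phi) (pairingB phi).

Lemma pairing_qbase phi x : pairing phi (qbase x) = phi x.
Proof.
rewrite /pairing (bigD1 x) //= ffunE eqxx mul1r big1 ?addr0 // => y.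
by rewrite ffunE eq_sym => /negPf ->; rewrite mul0r.
Qed.

Lemma pairing_qrmul phi u v :
  pairing phi (qrmul u v) =
  \sum_(x : Q) \sum_(y : Q) (u x)%:~R * (v y)%:~R * phi (qop x y).
Proof.
rewrite raddf_sum; apply: eq_bigr => x _.
rewrite raddf_sum; apply: eq_bigr => y _.
by rewrite raddfMz /= pairing_qbase -mulrzl intrM.
Qed.

End Pairing.

Lemma augmentation_pairing (Q : quandle) (u : {ffun Q -> int}) :
  augmentation u = pairing (fun=> 1) u.
Proof. by apply: eq_bigr => x _; rewrite mulr1 intz. Qed.

Lemma augmentationB (Q : quandle) (u v : {ffun Q -> int}) :
  augmentation (u - v) = augmentation u - augmentation v.
Proof. by rewrite !augmentation_pairing raddfB. Qed.

HB.instance Definition _ (Q : quandle) :=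
  GRing.isZmodMorphism.Build {ffun Q -> int} int (@augmentation Q)
    (@augmentationB Q).

Lemma augmentation_qrmul (Q : quandle) (u v : {ffun Q -> int}) :
  augmentation (qrmul u v) = augmentation u * augmentation v.
Proof.
rewrite augmentation_pairing pairing_qrmul mulr_suml; apply: eq_bigr => x _.
by rewrite mulr_sumr; apply: eq_bigr => y _; rewrite mulr1 !intz.
Qed.

Lemma qrmul_mulrn (Q : quandle) (u v : {ffun Q -> int}) n :
  qrmul (u *+ n) v = qrmul u v *+ n.
Proof.
rewrite /qrmul -sumrMnl; apply: eq_bigr => x _.
rewrite -sumrMnl; apply: eq_bigr => y _.
by rewrite ffunMnE mulrnAl -mulr_natr mulrzA natz -pmulrn.
Qed.

(** * Arithmetic modulo 7 *)

Lemma intr_Z7 (n : int) : (n%:~R == 0 :> 'Z_7) = (7 %| n)%Z.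
Proof. by rewrite (@dvdz_pcharf 'Z_7 7). Qed.

Lemma mulr7n_Z7 (y : 'Z_7) : y *+ 7 = 0.
Proof. by rewrite -mulr_natr C7_char mulr0. Qed.

Lemma natr_unit_Z7 (n : nat) : (0 < n < 7)%N -> (n%:R : 'Z_7) \is a GRing.unit.
Proof. by case: n => [|[|[|[|[|[|[|n]]]]]]]. Qed.

Lemma unit_Z7 (x : 'Z_7) : x != 0 -> x \is a GRing.unit.
Proof.
move=> x0; rewrite -(natr_Zp x) natr_unit_Z7 //.
by rewrite lt0n (ltn_ord x) andbT.
Qed.

(** * Moments *)

Definition moment (j : nat) : {ffun C7 -> int} -> 'Z_7 :=
  pairing (fun x : C7 => (x : 'Z_7) ^+ j).

HB.instance Definition _ j :=
  GRing.isZmodMorphism.Build {ffun C7 -> int} 'Z_7 (moment j)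
    (pairingB (fun x : C7 => (x : 'Z_7) ^+ j)).

Lemma moment0 u : moment 0 u = (augmentation u)%:~R.
Proof. by rewrite rmorph_sum; apply: eq_bigr => x _; rewrite expr0 mulr1. Qed.

(** At j = 0 the subtracted term is 0 ^+ 0 = 1, so that the formula is uniform
    in j. *)
Lemma moment_f j i : moment j (C7_f i) = i ^+ j - 0 ^+ j.
Proof. by rewrite raddfB /= /moment !pairing_qbase. Qed.

Lemma augmentation_f i : augmentation (C7_f i) = 0.
Proof. by rewrite raddfB /= !augmentation_pairing !pairing_qbase subrr. Qed.

(** The binomial theorem, with the factor 4 ^ j coming from the
    automorphism that separates the quandle ring from the group ring. *)
Lemma moment_qrmul j u v :
  moment j (qrmul u v) =
  4 ^+ j * \sum_(i < j.+1) moment (j - i) u * moment i v *+ 'C(j, i).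
Proof.
rewrite /moment pairing_qrmul.
under [X in _ * X]eq_bigr => i _.
  rewrite mulr_suml -sumrMnl.
  under eq_bigr => x _ do rewrite mulr_sumr -sumrMnl.
  over.
rewrite [X in _ * X]exchange_big mulr_sumr; apply: eq_bigr => x _.
rewrite [X in _ * X]exchange_big mulr_sumr; apply: eq_bigr => y _.
(* [exprDn] unguarded would expand the numeral 4 = 1 + (1 + (1 + 1)). *)
rewrite /= /C7_op exprMn (exprDn x y) !mulr_sumr; apply: eq_bigr => i _.
by rewrite mulrCA mulrnAr mulrACA.
Qed.

(** The augmentation vanishes in Z and the moments below r only modulo 7:
    for 1 <= r <= 7 this is the r-th power of Delta. *)
Definition moment_ideal (r : nat) : set {ffun C7 -> int} :=
  [set u | augmentation u = 0 /\ forall j, (j < r)%N -> moment j u = 0].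

Lemma moment_ideal_subgroup r : additive_subgroup (moment_ideal r).
Proof.
split; first by split=> [|j _]; rewrite raddf0.
move=> u v [au mu] [av mv].
by split=> [|j jr]; rewrite raddfB /= ?au ?av ?mu ?mv ?subr0.
Qed.

(** In each term of the binomial expansion of a moment of order at most r,
    either the moment of u has order less than r, or the moment of v has order
    0. *)
Lemma moment_ideal_qrmul r u v : moment_ideal r u -> augmentation v = 0 ->
  moment_ideal r.+1 (qrmul u v).
Proof.
move=> [au mu] av; split=> [|j]; first by rewrite augmentation_qrmul au mul0r.
rewrite ltnS => jr; rewrite moment_qrmul big_ord_recl.
rewrite moment0 av mulr0 mul0rn add0r big1 ?mulr0 // => i _.
by rewrite mu ?mul0r ?mul0rn // /= /bump; have := ltn_ord i; lia.
Qed.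

(** * Division by f_1 *)

Lemma C7_op_eq (x i z : 'Z_7) : (C7_op x i == z) = (x == 2 * z - i).
Proof.
have K y : 2 * C7_op y i - i = y.
  have -> : 2 * C7_op y i = 7 * (y + i) + (y + i) by rewrite /C7_op; ring.
  by rewrite C7_char mul0r add0r addrK.
apply/eqP/eqP => [<-|->]; first by rewrite K.
have -> : C7_op (2 * z - i) i = z + 7 * z by rewrite /C7_op; ring.
by rewrite C7_char mul0r addr0.
Qed.

(** In group-ring terms: the automorphism carries w (X - 1), a backward
    difference, to the coordinate z = 4 x, that is x = 2 z. *)
Lemma qrmul_f1E (w : {ffun C7 -> int}) (z : 'Z_7) :
  qrmul w (C7_f 1) z = w (2 * z - 1) - w (2 * z).
Proof.
have coordE (u : {ffun C7 -> int}) :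
    u z = pairing (fun x : C7 => (x == z)%:R) u.
  rewrite /pairing (bigD1 (z : C7)) //= eqxx mulr1 intz big1 ?addr0 // => x.
  by move=> /negPf ->; rewrite mulr0.
have pick i : \sum_(x : C7) w x * (qop x i == z)%:R = w (2 * z - i).
  rewrite (bigD1 (2 * z - i : C7)) //= C7_op_eq eqxx mulr1 big1 ?addr0 // => x.
  by rewrite C7_op_eq => /negPf ->; rewrite mulr0.
rewrite -[in RHS]pick -[2 * z in RHS]subr0 -pick -sumrB coordE pairing_qrmul.
apply: eq_bigr => x _; rewrite -mulrBr.
under eq_bigr => y _ do rewrite -mulrA.
rewrite -mulr_sumr intz; congr (_ * _).
rewrite -[LHS]/(pairing (fun y : C7 => (qop x y == z)%:R) (C7_f 1)).
by rewrite raddfB /= !pairing_qbase.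
Qed.

(** The tail sums of F form a cyclic antiderivative of F: at x = 0, where
    x - 1 wraps around to 6, this is where the total sum has to vanish. *)
Lemma sum_gt_pred (F : 'Z_7 -> int) (x : 'Z_7) : \sum_y F y = 0 ->
  \sum_(y : 'Z_7 | ((x - 1)%R < y)%N) F y - \sum_(y : 'Z_7 | (x < y)%N) F y
  = F x.
Proof.
have [->|x0] := eqVneq x 0 => F0.
  rewrite big_pred0; last by move=> y; apply/negbTE; rewrite -leqNgt -ltnS.
  rewrite (bigD1 0) //= in F0.
  apply/esym/eqP; rewrite sub0r -addr_eq0 -[eqbRHS]F0; apply/eqP; congr (_ + _).
  by apply: eq_bigl => y; rewrite lt0n.
have val_pred : (x - 1)%R = x.-1 :> nat.
  by case: x x0 {F0} => [[|[|[|[|[|[|[|//]]]]]]]].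
rewrite (bigD1 x); last by rewrite val_pred prednK // lt0n.
rewrite (eq_bigl (fun y : 'Z_7 => (x < y)%N)) ?addrK // => y.
have x1 : (0 < x)%N by rewrite lt0n.
by rewrite val_pred -val_eqE /=; lia.
Qed.

(** The moment of order j + 1 of w f_1 is, up to a unit, j + 1 times the moment
    of order j of w, plus terms with lower moments of w. The bound on r keeps
    j + 1 invertible modulo 7. *)
Lemma moment_ideal_of_qrmul_f1 r w : (r <= 6)%N -> augmentation w = 0 ->
  moment_ideal r.+1 (qrmul w (C7_f 1)) -> moment_ideal r w.
Proof.
move=> r6 aw [_ mw]; split=> // j; elim/ltn_ind: j => j IHj jr.
(* 2 is the inverse of 4. *)
have := mw j.+1 jr; rewrite moment_qrmul => /(congr1 ( *%R (2 ^+ j.+1))).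
rewrite mulrA -exprMn.
have -> : 2 * 4 = 1 + 7 :> 'Z_7 by ring.
rewrite C7_char addr0 expr1n mul1r mulr0 big_ord_recl big_ord_recl big1.
  rewrite /= !moment_f subrr mulr0 mul0rn add0r addr0 /bump /= subn1 /=.
  rewrite !expr1 subr0 mulr1 bin1 -mulr_natr => /(canRL (mulrK _)) ->.
    by rewrite mul0r.
  by apply: natr_unit_Z7; lia.
move=> i _; rewrite IHj ?mul0r ?mul0rn // /= /bump /=; have := ltn_ord i; lia.
Qed.

(** The counterpart of dividing a multiple of (X - 1)^(r+1) by X - 1. It makes
    one product by f_1 enough, with no sum of products. *)
Lemma moment_ideal_factor r u : (0 < r <= 6)%N -> moment_ideal r.+1 u ->
  exists2 w, moment_ideal r w & u = qrmul w (C7_f 1).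
Proof.
move=> /andP[r0 r6] Lu; have [au mu] := Lu.
(* Precomposing with x |-> 4 x turns the equation u = w f_1 into one about
   differences of w. *)
pose F (y : 'Z_7) : int := u (4 * y).
have inv2 (x : 'Z_7) : 4 * (2 * x) = x.
  have -> : 4 * (2 * x) = 7 * x + x by ring.
  by rewrite C7_char mul0r add0r.
have inv4 (x : 'Z_7) : 2 * (4 * x) = x by rewrite mulrCA inv2.
have reindex4 (R : nmodType) (G : 'Z_7 -> R) : \sum_x G (4 * x) = \sum_x G x.
  by rewrite [RHS](reindex_inj (can_inj inv4)).
have F0 : \sum_y F y = 0 by rewrite (reindex4 int u).
(* The tail sums of F have total sum \sum_y y * F y, which is 2 * moment 1 u
   modulo 7; subtracting the constant c removes it. *)
have [c Ec] : exists c, \sum_(y : 'Z_7) F y *+ y = c * 7.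
  apply/dvdzP; rewrite -intr_Z7 rmorph_sum /=.
  apply/eqP; transitivity (2 * moment 1 u); last by rewrite mu // mulr0.
  rewrite /moment /pairing mulr_sumr.
  rewrite -(reindex4 _ (fun x : 'Z_7 => 2 * ((u x)%:~R * x ^+ 1))).
  apply: eq_bigr => y _.
  by rewrite expr1 mulrCA inv4 rmorphMn /= -mulr_natr natr_Zp.
pose w : {ffun C7 -> int} :=
  [ffun x : 'Z_7 => \sum_(y : 'Z_7 | (x < y)%N) F y - c].
have uE : u = qrmul w (C7_f 1).
  apply/ffunP => z; rewrite qrmul_f1E !ffunE opprB addrA subrK.
  by rewrite sum_gt_pred // /F inv2.
exists w => //; apply: moment_ideal_of_qrmul_f1 => //; last by rewrite -uE.
rewrite /augmentation; under eq_bigr => x _ do rewrite ffunE.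
apply/eqP; rewrite sumrB subr_eq0 (exchange_big_dep xpredT) //=.
rewrite sumr_const card_ord -[c *+ _]mulr_natr -Ec; apply/eqP.
apply: eq_bigr => y _.
by rewrite (big_ord_narrow (ltnW (ltn_ord y))) sumr_const card_ord.
Qed.

(** * Divisibility by interpolation *)

Lemma moment_ideal_horner r u (P : {poly 'Z_7}) :
    (size P <= r)%N -> moment_ideal r u ->
  \sum_(x : 'Z_7) (u x)%:~R * P.[x] = 0.
Proof.
move=> sP [_ mu].
under eq_bigr => x _ do rewrite (horner_coef_wide _ sP) mulr_sumr.
rewrite exchange_big big1 // => j _.
under eq_bigr => x _ do rewrite mulrCA.
rewrite -mulr_sumr -[X in _ * X]/(moment j u) mu ?mulr0 //; exact: ltn_ord.
Qed.

(** Such a u is supported on the r points 0, 8 - r, ..., 6; pairing it with the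
    monic polynomial of degree r - 1 that vanishes at all of them but x leaves a
    unit times u x. *)
Lemma moment_ideal_dvd r u : (0 < r <= 7)%N -> moment_ideal r u ->
    (forall x : 'Z_7, (0 < x <= 7 - r)%N -> u x = 0) ->
  forall x : 'Z_7, (7 %| u x)%Z.
Proof.
move=> /andP[r0 r7] Lu u0 x.
have [/u0 -> //|xN] := boolP (0 < x <= 7 - r)%N; rewrite -intr_Z7.
pose nodes := 0%N :: iota (8 - r) r.-1.
have nodesE (y : 'Z_7) : (y : nat) \in nodes = ~~ (0 < y <= 7 - r)%N.
  have y7 : (y < 7)%N := ltn_ord y.
  by rewrite inE mem_iota; lia.
have nodes_uniq : uniq nodes.
  by rewrite /= iota_uniq mem_iota andbT; lia.
pose t := rem (x : nat) nodes.
pose P : {poly 'Z_7} := \prod_(i <- t) ('X - i%:R%:P).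
have PE y : P.[y] = \prod_(i <- t) (y - i%:R).
  by rewrite horner_prod; apply: eq_bigr => i _; rewrite hornerXsubC.
have sP : (size P <= r)%N.
  have -> : P = \prod_(c <- [seq i%:R | i <- t]) ('X - c%:P) by rewrite big_map.
  rewrite size_prod_XsubC size_map size_rem ?nodesE //=.
  by rewrite size_iota prednK.
have := moment_ideal_horner sP Lu.
rewrite (bigD1 x) //= big1 ?addr0; last first.
  move=> y yx; have [yN|] := boolP ((y : nat) \in nodes); last first.
    by rewrite nodesE negbK => /u0 ->; rewrite mul0r.
  have yt : (y : nat) \in t by rewrite mem_rem_uniq // !inE val_eqE yx.
  by rewrite PE (big_rem _ yt) /= natr_Zp subrr mul0r mulr0.
move=> /(canRL (mulrK _)) ->; first by rewrite mul0r.
rewrite PE big_seq.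
apply: (big_ind (fun z : 'Z_7 => z \is a GRing.unit)) => [|y z uy uz|i].
- exact: unitr1.
- by rewrite unitrM uy.
rewrite mem_rem_uniq // => /andP[ix it]; apply: unit_Z7; rewrite subr_eq0.
apply: contra ix => /eqP ->; rewrite val_Zp_nat // modn_small //.
by move: it; rewrite inE mem_iota; lia.
Qed.

Lemma augmentation_divisible (u : {ffun C7 -> int}) :
    augmentation u = 0 -> (forall x : 'Z_7, (7 %| u x)%Z) ->
  exists2 v : {ffun C7 -> int}, augmentation v = 0 & u = v *+ 7.
Proof.
move=> au du; pose v : {ffun C7 -> int} := [ffun x => (u x %/ 7)%Z].
have uv : u = v *+ 7.
  by apply/ffunP => x; rewrite -[LHS](divzK (du x)) ffunMnE ffunE; ring.
exists v => //; apply/eqP; move: au; rewrite uv raddfMn => /eqP.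
by rewrite mulrn_eq0.
Qed.

(** Seven vanishing moments modulo 7 on seven points leave nothing modulo 7. *)
Lemma moment_ideal7 : moment_ideal 7 = [set v *+ 7 | v in moment_ideal 1].
Proof.
apply/seteqP; split=> [u Lu | _ [v [av _] <-]].
  have du : forall x : 'Z_7, (7 %| u x)%Z.
    by apply: (moment_ideal_dvd _ Lu) => // x; case: (nat_of_ord x).
  have [v av ->] := augmentation_divisible Lu.1 du.
  by exists v => //; split=> // -[] // _; rewrite moment0 av.
by split=> [|j _]; rewrite raddfMn /= ?av ?mul0rn ?mulr7n_Z7.
Qed.

(** * Reduced bases *)

Lemma augmentation_f_expand (u : {ffun C7 -> int}) : augmentation u = 0 ->
  u = \sum_(i < 6) C7_f i.+1%:R *~ u i.+1%:R.
Proof.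
move=> au; transitivity (\sum_(x : 'Z_7) C7_f x *~ u x).
  under eq_bigr => x _ do rewrite mulrzBl.
  rewrite sumrB -mulrz_sumr -[\sum_x u x]/(augmentation u) au mulr0z subr0.
  apply/ffunP => z; rewrite sum_ffunE (bigD1 (z : 'Z_7)) //= big1.
    by rewrite addr0 ffunMzE ffunE eqxx intz.
  by move=> x xz; rewrite ffunMzE ffunE (negPf xz) mul0rz.
rewrite big_ord_recl {1}/C7_f subrr mul0rz add0r; apply: eq_bigr => i _.
have -> // : lift ord0 i = i.+1%:R :> 'Z_7.
by apply: val_inj; rewrite /= val_Zp_nat // modn_small // ltnS.
Qed.

(** The common shape of the six lists of the theorem, up to a power of 7: an
    echelon form, whose first 7 - r members are dual to the coordinates
    1, ..., 7 - r. The member at position i goes with the coordinate i + 1. *)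
Definition reduced_basis r (s : seq {ffun C7 -> int}) : Prop :=
  [/\ size s = 6%N,
      forall i, (i < 7 - r)%N -> moment_ideal r s`_i,
      forall i j, (i < 7 - r)%N -> (j < 7 - r)%N ->
        s`_i j.+1%:R = (i == j)%:R &
      forall i, (7 - r <= i < 6)%N -> s`_i = C7_f i.+1%:R *+ 7].

(** Subtracting the combination of the dual members that has the same first
    coordinates as v leaves an element to which the interpolation argument
    applies, hence a combination of the 7 f_i. *)
Lemma moment_ideal_Zspan r s : (0 < r <= 7)%N -> reduced_basis r s ->
  moment_ideal r = Zspan s.
Proof.
move=> r17 [ss Ls dual s7].
have Ls' i : (i < 6)%N -> moment_ideal r s`_i.
  move=> i6; have [/Ls //|ri] := ltnP i (7 - r).
  rewrite s7 ?ri //; split=> [|j _]; rewrite raddfMn /=.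
    by rewrite augmentation_f mul0rn.
  by rewrite mulr7n_Z7.
have LG := moment_ideal_subgroup r.
apply/seteqP; split=> [v Lv | _ /ZspanP[a ->]]; last first.
  apply: subgroup_sum => // i _; apply: subgroup_mulrz => //.
  by apply: Ls'; rewrite -ss.
pose v' := v - \sum_(i < 6 | (i < 7 - r)%N) s`_i *~ v i.+1%:R.
have Lv' : moment_ideal r v'.
  apply: LG.2 => //; apply: subgroup_sum => // i _.
  by apply: subgroup_mulrz => //; apply: Ls'.
have v'0 j : (j < 7 - r)%N -> v' j.+1%:R = 0.
  move=> jr; have j6 : (j < 6)%N by lia.
  rewrite !ffunE sum_ffunE (bigD1 (Ordinal j6)) //= big1.
    by rewrite addr0 ffunMzE dual // eqxx intz subrr.
  move=> i /andP[ir ij]; rewrite ffunMzE dual // -val_eqE /= in ij *.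
  by rewrite (negPf ij) mul0rz.
have [w aw Ev'] :
    exists2 w : {ffun C7 -> int}, augmentation w = 0 & v' = w *+ 7.
  apply: augmentation_divisible Lv'.1 (moment_ideal_dvd r17 Lv' _).
  move=> x /andP[x0 xr].
  by rewrite -(natr_Zp x) -(prednK x0) v'0 // prednK.
have w0 j : (j < 7 - r)%N -> w j.+1%:R = 0.
  by move=> /v'0/eqP; rewrite Ev' ffunMnE mulrn_eq0 => /eqP.
apply/ZspanP; rewrite ss.
exists (fun i => if (i < 7 - r)%N then v i.+1%:R else w i.+1%:R).
rewrite -[LHS](subrK (\sum_(i < 6 | (i < 7 - r)%N) s`_i *~ v i.+1%:R)) -/v' Ev'.
rewrite {1}(augmentation_f_expand aw) -sumrMnl.
rewrite [X in _ + X]big_mkcond -big_split.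
apply: eq_bigr => i _ /=; case: ltnP => ir.
  by rewrite w0 // mulr0z mul0rn add0r.
by rewrite addr0 s7 ?ir ?ltn_ord // !pmulrn mulrzAC.
Qed.

(** * Powers of the augmentation ideal *)

Lemma moment_ideal_mul k r : (0 < r <= 6)%N ->
  subgroup_mul [set v *+ 7 ^ k | v in moment_ideal r] (augmentation_ideal C7) =
  [set v *+ 7 ^ k | v in moment_ideal r.+1].
Proof.
move=> r06; apply/seteqP; split.
  apply: smallest_sub => [|_ [_ [b [[u Lu <-] ab ->]]]].
    have [L0 LB] := moment_ideal_subgroup r.+1.
    split; first by exists 0; rewrite ?mul0rn.
    move=> _ _ [u Lu <-] [v Lv <-]; exists (u - v); first exact: LB.
    by rewrite mulrnBl.
  exists (qrmul u b); last by rewrite qrmul_mulrn.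
  exact: moment_ideal_qrmul.
move=> _ [u /(moment_ideal_factor r06)[w Lw ->] <-].
apply: sub_gen_smallest; exists (w *+ 7 ^ k), (C7_f 1).
by split; [exists w | exact: augmentation_f | rewrite qrmul_mulrn].
Qed.

(** The pattern has period 6 because L_7 = 7 L_1 restarts it with one more
    factor 7. *)
Lemma augmentation_powerE k r : (0 < r <= 7)%N ->
  augmentation_power C7 (6 * k + r) = [set v *+ 7 ^ k | v in moment_ideal r].
Proof.
have L1 : moment_ideal 1 = augmentation_ideal C7.
  apply/seteqP; split=> [u [] // | u au]; split=> // -[] // _.
  by rewrite moment0 (au : augmentation u = 0).
have up j :
    augmentation_power C7 (6 * j + 1) =
    [set v *+ 7 ^ j | v in moment_ideal 1] ->
    forall i, (i <= 6)%N ->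
    augmentation_power C7 (6 * j + i.+1) =
    [set v *+ 7 ^ j | v in moment_ideal i.+1].
  move=> E1; elim=> [//|i IHi] i6.
  rewrite -moment_ideal_mul // -IHi 1?ltnW // /augmentation_power.
  by rewrite !addnS /=.
have base j :
    augmentation_power C7 (6 * j + 1) = [set v *+ 7 ^ j | v in moment_ideal 1].
  elim: j => [|j /up/(_ 6 isT) E].
    by rewrite L1 expn0 image_id.
  rewrite (_ : 6 * j.+1 + 1 = 6 * j + 7)%N; last by lia.
  rewrite E moment_ideal7 image_comp; apply: eq_imagel => v _ /=.
  by rewrite -mulrnA expnS.
case: r => [//|r]; exact: up (base k) r.
Qed.

Lemma augmentation_power_Zspan k r s : (0 < r <= 7)%N -> reduced_basis r s ->
  augmentation_power C7 (6 * k + r) = Zspan [seq x *+ 7 ^ k | x <- s].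
Proof.
move=> r17 sB.
by rewrite augmentation_powerE // Zspan_mulrn (moment_ideal_Zspan r17 sB).
Qed.

(** * The six bases *)

(** These restate [raddfD] and [raddfMn] with a rigid head symbol, so that
    rewriting stops at the f_i instead of unfolding them into a_i - a_0. *)
Lemma augmentationD (u v : {ffun C7 -> int}) :
  augmentation (u + v) = augmentation u + augmentation v.
Proof. exact: raddfD. Qed.

Lemma augmentationMn (u : {ffun C7 -> int}) n :
  augmentation (u *+ n) = augmentation u *+ n.
Proof. exact: raddfMn. Qed.

Lemma momentD j u v : moment j (u + v) = moment j u + moment j v.
Proof. exact: raddfD. Qed.

Lemma momentMn j u n : moment j (u *+ n) = moment j u *+ n.
Proof. exact: raddfMn. Qed.

Ltac nat_cases n :=
  lazymatch n with
  | O => idtac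
  | S ?m => case; [ | nat_cases m]
  end.

Ltac check_reduced_basis :=
  split=> //;
  [ nat_cases 6%N => //= _; (split;
    [ by rewrite !(augmentation_f, augmentationD, augmentationMn, mul0rn)
    | nat_cases 7%N => //= _; rewrite !(moment_f, momentD, momentMn);
      apply/eqP; vm_compute; reflexivity ])
  | nat_cases 6%N => //=; nat_cases 6%N => //= _ _;
    rewrite !ffunE; apply/eqP; vm_compute; reflexivity
  | nat_cases 6%N => //= ].

Lemma reduced_basis1 : reduced_basis 1
  [:: C7_f 1;
      C7_f 2;
      C7_f 3;
      C7_f 4;
      C7_f 5;
      C7_f 6].
Proof. check_reduced_basis. Qed.

Lemma reduced_basis2 : reduced_basis 2
  [:: C7_f 1 + C7_f 6;
      C7_f 2 + C7_f 6 *+ 2;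
      C7_f 3 + C7_f 6 *+ 3;
      C7_f 4 + C7_f 6 *+ 4;
      C7_f 5 + C7_f 6 *+ 5;
      C7_f 6 *+ 7].
Proof. check_reduced_basis. Qed.

Lemma reduced_basis3 : reduced_basis 3
  [:: C7_f 1 + C7_f 5 *+ 6 + C7_f 6 *+ 3;
      C7_f 2 + C7_f 5 *+ 4 + C7_f 6;
      C7_f 3 + C7_f 5 + C7_f 6;
      C7_f 4 + C7_f 5 *+ 4 + C7_f 6 *+ 3;
      C7_f 5 *+ 7;
      C7_f 6 *+ 7].
Proof. check_reduced_basis. Qed.

Lemma reduced_basis4 : reduced_basis 4
  [:: C7_f 1 + C7_f 4 + C7_f 5 *+ 3 + C7_f 6 *+ 6;
      C7_f 2 + C7_f 4 *+ 4 + C7_f 5 *+ 6 + C7_f 6 *+ 6;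
      C7_f 3 + C7_f 4 *+ 3 + C7_f 5 *+ 6 + C7_f 6 *+ 3;
      C7_f 4 *+ 7;
      C7_f 5 *+ 7;
      C7_f 6 *+ 7].
Proof. check_reduced_basis. Qed.

Lemma reduced_basis5 : reduced_basis 5
  [:: C7_f 1 + C7_f 3 *+ 6 + C7_f 4 *+ 5 + C7_f 5 *+ 4 + C7_f 6 *+ 3;
      C7_f 2 + C7_f 3 *+ 2 + C7_f 4 *+ 3 + C7_f 5 *+ 4 + C7_f 6 *+ 5;
      C7_f 3 *+ 7;
      C7_f 4 *+ 7;
      C7_f 5 *+ 7;
      C7_f 6 *+ 7].
Proof. check_reduced_basis. Qed.

Lemma reduced_basis6 : reduced_basis 6
  [:: C7_f 1 + C7_f 2 + C7_f 3 + C7_f 4 + C7_f 5 + C7_f 6;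
      C7_f 2 *+ 7;
      C7_f 3 *+ 7;
      C7_f 4 *+ 7;
      C7_f 5 *+ 7;
      C7_f 6 *+ 7].
Proof. check_reduced_basis. Qed.

Theorem proposition5p8 :
  let f := C7_f in
  let Delta := augmentation_power C7 in
  (forall k : nat, (1 <= k)%N ->
        Delta (6 * k)%N =
        Zspan [:: (f 1 + f 2 + f 3 + f 4 + f 5 + f 6) *+ (7 ^ (k - 1))%N;
                  f 2 *+ (7 ^ k)%N;
                  f 3 *+ (7 ^ k)%N;
                  f 4 *+ (7 ^ k)%N;
                  f 5 *+ (7 ^ k)%N;
                  f 6 *+ (7 ^ k)%N])
  /\ (forall k : nat,
        Delta (6 * k + 1)%N =
        Zspan [:: f 1 *+ (7 ^ k)%N;
                  f 2 *+ (7 ^ k)%N;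
                  f 3 *+ (7 ^ k)%N;
                  f 4 *+ (7 ^ k)%N;
                  f 5 *+ (7 ^ k)%N;
                  f 6 *+ (7 ^ k)%N])
  /\ (forall k : nat,
        Delta (6 * k + 2)%N =
        Zspan [:: (f 1 + f 6) *+ (7 ^ k)%N;
                  (f 2 + f 6 *+ 2) *+ (7 ^ k)%N;
                  (f 3 + f 6 *+ 3) *+ (7 ^ k)%N;
                  (f 4 + f 6 *+ 4) *+ (7 ^ k)%N;
                  (f 5 + f 6 *+ 5) *+ (7 ^ k)%N;
                  f 6 *+ (7 ^ (k + 1))%N])
  /\ (forall k : nat,
        Delta (6 * k + 3)%N =
        Zspan [:: (f 1 + f 5 *+ 6 + f 6 *+ 3) *+ (7 ^ k)%N;
                  (f 2 + f 5 *+ 4 + f 6) *+ (7 ^ k)%N;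
                  (f 3 + f 5 + f 6) *+ (7 ^ k)%N;
                  (f 4 + f 5 *+ 4 + f 6 *+ 3) *+ (7 ^ k)%N;
                  f 5 *+ (7 ^ (k + 1))%N;
                  f 6 *+ (7 ^ (k + 1))%N])
  /\ (forall k : nat,
        Delta (6 * k + 4)%N =
        Zspan [:: (f 1 + f 4 + f 5 *+ 3 + f 6 *+ 6) *+ (7 ^ k)%N;
                  (f 2 + f 4 *+ 4 + f 5 *+ 6 + f 6 *+ 6) *+ (7 ^ k)%N;
                  (f 3 + f 4 *+ 3 + f 5 *+ 6 + f 6 *+ 3) *+ (7 ^ k)%N;
                  f 4 *+ (7 ^ (k + 1))%N;
                  f 5 *+ (7 ^ (k + 1))%N;
                  f 6 *+ (7 ^ (k + 1))%N])
  /\ (forall k : nat,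
        Delta (6 * k + 5)%N =
        Zspan [::
          (f 1 + f 3 *+ 6 + f 4 *+ 5 + f 5 *+ 4 + f 6 *+ 3) *+ (7 ^ k)%N;
          (f 2 + f 3 *+ 2 + f 4 *+ 3 + f 5 *+ 4 + f 6 *+ 5) *+ (7 ^ k)%N;
          f 3 *+ (7 ^ (k + 1))%N;
          f 4 *+ (7 ^ (k + 1))%N;
          f 5 *+ (7 ^ (k + 1))%N;
          f 6 *+ (7 ^ (k + 1))%N]).
Proof.
move=> f Delta; rewrite /f /Delta; do ![split].
- case=> [//|k _].
  (* The exponent 6 k' closes the period that starts at 6 (k' - 1) + 1. *)
  rewrite (_ : 6 * k.+1 = 6 * k + 6)%N; last by lia.
  rewrite (augmentation_power_Zspan k _ reduced_basis6) //=.
  by rewrite subn1 expnS !mulrnA.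
- by move=> k; rewrite (augmentation_power_Zspan k _ reduced_basis1).
- move=> k; rewrite (augmentation_power_Zspan k _ reduced_basis2) //=.
  by rewrite addn1 expnS !mulrnA.
- move=> k; rewrite (augmentation_power_Zspan k _ reduced_basis3) //=.
  by rewrite addn1 expnS !mulrnA.
- move=> k; rewrite (augmentation_power_Zspan k _ reduced_basis4) //=.
  by rewrite addn1 expnS !mulrnA.
- move=> k; rewrite (augmentation_power_Zspan k _ reduced_basis5) //=.
  by rewrite addn1 expnS !mulrnA.
Qed.
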